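(* Let $\psi: T \to \mathbb{C}$ be a function and $\varphi: T \to T$ a self-map for which $W_{\psi,\varphi}$ is bounded on $L_\mu^\infty$ (respectively $L_\mu^0$). Then $W_{\psi,\varphi}$ has closed range on $L_\mu^\infty$ (respectively $L_\mu^0$) if and only if there is an $\varepsilon > 0$ such that $U_\varepsilon \cap S_w \ne \emptyset$ for every $w \in Z^c$, where $$U_\varepsilon = \left\{v \in T : \frac{\mu(v)}{\mu(\varphi(v))}|\psi(v)| \ge \varepsilon\right\}, \qquad S_w = \{v \in T : \varphi(v) = \varphi(w)\}, \qquad Z^c = \{v \in T : \psi(v) \ne 0\}.$$
   Context: $(T,\mathrm{d})$ is a metric space with a distinguished point $o$ (the root); the length of $v \in T$ is $|v| = \mathrm{d}(o,v)$. $T$ is assumed locally finite (for every $M>0$ the set $\{v \in T : |v| < M\}$ is finite) and unbounded (for every $M>0$ there is $v \in T$ with $|v| \ge M$). $\mu: T \to (0,\infty)$ is an arbitrary positive function (a weight). $L_\mu^\infty$ is the Banach space of functions $f: T \to \mathbb{C}$ with $\|f\|_\mu = \sup_{v \in T} \mu(v)|f(v)| < \infty$, and $L_\mu^0$ is its closed subspace of those $f$ with $\lim_{|v|\to\infty} \mu(v)|f(v)| = 0$. The weighted composition operator is the linear map $W_{\psi,\varphi} f = \psi\,(f\circ\varphi)$; it is bounded on a space if it is a bounded operator from that space to itself. *)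

(* Defs.v *)
From HB Require Import structures.
From mathcomp Require Import all_boot all_order all_algebra.
From mathcomp Require Import complex.
From mathcomp Require Import all_classical all_reals all_analysis.

Set Implicit Arguments.
Unset Strict Implicit.
Unset Printing Implicit Defensive.

Import Order.TTheory GRing.Theory Num.Theory.
Import numFieldNormedType.Exports.
Import ComplexField.Normc.

Local Open Scope classical_set_scope.
Local Open Scope complex_scope.
Local Open Scope ring_scope.

(* [normc z] is the modulus of z as an element of R, whereas [`|z|] lives
   in R[i]. *)

Section WeightedSup.
Context {R : realType} {T : Type} (mu : T -> {posnum R}).
Implicit Types f g : T -> R[i].

Definition wsup_set f : set R := range (fun v => (mu v)%:num * normc (f v)).

Definition wsup f : R := sup (wsup_set f).

Definition wbounded : {pred T -> R[i]} := fun f => `[< has_ubound (wsup_set f) >].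

Lemma wboundedP f :
  reflect (exists M, forall v, (mu v)%:num * normc (f v) <= M) (f \in wbounded).
Proof.
apply: (iffP (asboolP _)) => -[M fM]; exists M.
  by move=> v; apply: fM; exists v.
by move=> _ [v _ <-].
Qed.

Lemma normc_ge0 (z : R[i]) : 0 <= normc z.
Proof. by case: z => a b; exact: sqrtr_ge0. Qed.

Lemma normcD (y z : R[i]) : normc (y + z) <= normc y + normc z.
Proof. exact: le_normcD. Qed.

Lemma wbounded_submod_closed : submod_closed wbounded.
Proof.
split=> [|a f g /wboundedP[M fM] /wboundedP[N gN]]; apply/wboundedP.
  by exists 0 => v; rewrite normc0 mulr0.
exists (normc a * M + N) => v.
rewrite (le_trans (ler_wpM2l _ (normcD _ _)))// mulrDr lerD//.
by rewrite normcM mulrCA ler_wpM2l// normc_ge0.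
Qed.

Lemma wsup_ub f v : f \in wbounded -> (mu v)%:num * normc (f v) <= wsup f.
Proof. by move=> /asboolP fb; apply: ub_le_sup => //; exists v. Qed.

Lemma wsup_le f M : 0 <= M ->
  (forall v, (mu v)%:num * normc (f v) <= M) -> wsup f <= M.
Proof.
move=> M0 fM; rewrite /wsup.
have [->|/set0P fn0] := eqVneq (wsup_set f) set0; first by rewrite sup0.
by apply: ge_sup => // _ [v _ <-].
Qed.

Lemma wsup_ge0 f : 0 <= wsup f.
Proof.
rewrite /wsup; have [fs|/sup_out ->//] := pselect (has_sup (wsup_set f)).
have [[_ [v _ _]] fb] := fs.
apply: le_trans (ub_le_sup fb (imageP _ (I : setT v))).
by rewrite mulr_ge0 ?normc_ge0.
Qed.

End WeightedSup.

HB.instance Definition _ (R : realType) (T : Type) (mu : T -> {posnum R}) :=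
  GRing.isSubmodClosed.Build R[i] (T -> R[i]) (wbounded mu)
    (wbounded_submod_closed mu).

Section Linf.
Context {R : realType} {T : Type} (mu : T -> {posnum R}).

Record Linf := MkLinf {
  Linf_fun :> T -> R[i];
  Linf_funP : Linf_fun \in wbounded mu }.

HB.instance Definition _ := [isSub for Linf_fun].
HB.instance Definition _ := [Choice of Linf by <:].
HB.instance Definition _ := [SubChoice_isSubLmodule of Linf by <:].

Definition Linf_norm (f : Linf) : R[i] := (wsup mu f)%:C.

Lemma Linf_normD f g : Linf_norm (f + g) <= Linf_norm f + Linf_norm g.
Proof.
rewrite /Linf_norm -rmorphD/= lecR wsup_le ?addr_ge0 ?wsup_ge0// => v.
rewrite (le_trans (ler_wpM2l _ (normcD _ _)))// mulrDr.
by rewrite lerD// wsup_ub ?Linf_funP.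
Qed.

Lemma wsupZ_le (a : R[i]) (f : Linf) : wsup mu (a *: f) <= normc a * wsup mu f.
Proof.
apply: wsup_le => [|v]; first by rewrite mulr_ge0 ?normc_ge0 ?wsup_ge0.
rewrite [normc _]normcM mulrCA ler_wpM2l ?normc_ge0//.
by rewrite wsup_ub ?Linf_funP.
Qed.

Lemma Linf_normZ (a : R[i]) f : Linf_norm (a *: f) = `|a| * Linf_norm f.
Proof.
rewrite /Linf_norm; have -> : `|a| = (normc a)%:C by [].
rewrite -rmorphM/=; congr (_%:C); apply/eqP; rewrite eq_le wsupZ_le/=.
have [->|a0] := eqVneq a 0; first by rewrite normc0 mul0r wsup_ge0.
have na0 : 0 < normc a.
  by rewrite lt_def normc_ge0 andbT; apply: contra_neq a0; exact: eq0_normc.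
rewrite -ler_pdivlMl// -normcV.
by have := wsupZ_le a^-1 (a *: f); rewrite scalerA mulVf// scale1r.
Qed.

Lemma Linf_norm_eq0 f : Linf_norm f = 0 -> f = 0.
Proof.
move=> /eqP; rewrite /Linf_norm (_ : 0 = 0%:C)// => /eqP[f0].
apply/val_inj/funext => v /=; apply: eq0_normc.
apply/eqP; rewrite eq_le normc_ge0 andbT -(pmulr_rle0 _ (gt0 (mu v))).
by rewrite -[leRHS]f0 wsup_ub ?Linf_funP.
Qed.

HB.instance Definition _ :=
  Lmodule_isNormed.Build R[i] Linf Linf_normD Linf_normZ Linf_norm_eq0.

End Linf.

Section Lzero.
Context {R : realType} {T : metricType R} (o : T) (mu : T -> {posnum R}).

(* The filter |v| -> oo, where |v| = mdist o v. *)
Definition len_pinfty : set_system T :=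
  filter_from [set: R] (fun M => [set v | M <= mdist o v]).

Global Instance len_pinfty_filter : Filter len_pinfty.
Proof.
apply: filter_from_filter => [|M N _ _]; first by exists 0.
by exists (Num.max M N) => // v /=; rewrite ge_max => /andP[].
Qed.

Definition wvanishing : {pred Linf mu} :=
  fun f => `[< (mu v)%:num * normc (f v) @[v --> len_pinfty] --> (0 : R) >].

Lemma wvanishing_submod_closed : submod_closed wvanishing.
Proof.
split=> [|a f g /asboolP f0 /asboolP g0]; apply/asboolP.
  by under eq_fun do rewrite normc0 mulr0; exact: cvg_cst.
have h0 : normc a * ((mu v)%:num * normc (f v)) + (mu v)%:num * normc (g v)
    @[v --> len_pinfty] --> (0 : R).
  rewrite -[X in _ --> X]addr0 -[X in _ --> X + _](mulr0 (normc a)).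
  by apply: cvgD => //; apply: cvgMr.
apply: (squeeze_cvgr _ (cvg_cst (0 : R)) h0); apply: nearW => v.
rewrite mulr_ge0 ?normc_ge0//=.
rewrite (le_trans (ler_wpM2l _ (normcD _ _)))// mulrDr lerD//.
by rewrite normcM mulrCA.
Qed.

HB.instance Definition _ :=
  GRing.isSubmodClosed.Build R[i] (Linf mu) wvanishing wvanishing_submod_closed.

Record Lzero := MkLzero {
  Lzero_Linf :> Linf mu;
  Lzero_LinfP : Lzero_Linf \in wvanishing }.

HB.instance Definition _ := [isSub for Lzero_Linf].
HB.instance Definition _ := [Choice of Lzero by <:].
HB.instance Definition _ := [SubChoice_isSubLmodule of Lzero by <:].

Definition Lzero_norm (f : Lzero) : R[i] := `|Lzero_Linf f|.

Lemma Lzero_normD f g : Lzero_norm (f + g) <= Lzero_norm f + Lzero_norm g.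
Proof. exact: ler_normD. Qed.

Lemma Lzero_normZ (a : R[i]) f : Lzero_norm (a *: f) = `|a| * Lzero_norm f.
Proof. exact: normrZ. Qed.

Lemma Lzero_norm_eq0 f : Lzero_norm f = 0 -> f = 0.
Proof. by move=> f0; apply/val_inj/normr0_eq0. Qed.

HB.instance Definition _ :=
  Lmodule_isNormed.Build R[i] Lzero Lzero_normD Lzero_normZ Lzero_norm_eq0.

End Lzero.

Definition bounded_operator {K : numFieldType} {V : normedModType K}
  (W : {linear V -> V}) : Prop := exists M : K, forall x, `|W x| <= M * `|x|.

Section WeightedComposition.
Context {R : realType} {T : Type}.
Variables (mu : T -> {posnum R}) (psi : T -> R[i]) (phi : T -> T).

Definition wcomp (f : T -> R[i]) : T -> R[i] := fun v => psi v * f (phi v).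

Definition Uset (eps : R) : set T :=
  [set v | eps <= (mu v)%:num / (mu (phi v))%:num * normc (psi v)].

Definition Sset (w : T) : set T := [set v | phi v = phi w].

Definition Zc : set T := [set v | psi v <> 0].

End WeightedComposition.

(* Main.v *)
(** The gain of [u] is the norm of [W e_u], where [e_u] is the unit vector
    concentrated at [u], i.e. the supremum of [mu v / mu u * |psi v|] over the
    fibre [phi v = u]; the criterion says that the nonzero gains are bounded
    below.

    If every fibre with nonzero gain contains a point [v_u] where the ratio is
    at least [eps], then [g u = G (v_u) / psi (v_u)] is a preimage of any [G]
    in the closure of the range, since the relations
    [G v * psi w = G w * psi v] on the fibres survive pointwise limits.

    If the gains accumulate at [0], take [f] of weighted modulus
    [gain u ^ (-1/2)] on a set of points along which the gains tend to [0].
    The finite truncations of [f] belong to the space and their images converge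
    uniformly to [W f], but a preimage of [W f] must agree with the unbounded
    [f]. *)

Require Import Defs.
From HB Require Import structures.
From mathcomp Require Import all_boot all_order all_algebra.
From mathcomp Require Import complex.
From mathcomp Require Import all_classical all_reals all_analysis.
From mathcomp Require Import ring lra.

Set Implicit Arguments.
Unset Strict Implicit.
Unset Printing Implicit Defensive.

Import Order.TTheory GRing.Theory Num.Theory.
Import numFieldNormedType.Exports.
Import ComplexField.Normc.

Local Open Scope classical_set_scope.
Local Open Scope complex_scope.
Local Open Scope ring_scope.

Lemma normc_real (R : realType) (a : R) : normc a%:C = `|a|.
Proof. by rewrite /= expr0n addr0 sqrtr_sqr. Qed.

Lemma finite_set_argmin (R : realType) (T : eqType) (l : T -> R) (A : set T) :
  finite_set A -> A !=set0 -> exists2 u, A u & forall v, A v -> l u <= l v.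
Proof.
move=> /finite_seqP[s ->]; elim: s => [[]//|a s IH] _.
case: s IH => [_|b s /(_ (ex_intro _ b (mem_head _ _)))[u us umin]].
  by exists a => [|v]; rewrite /= inE // => /eqP ->.
have [lau|lua] := leP (l a) (l u).
  exists a => [|v]; rewrite /= in_cons ?eqxx// => /predU1P[->//|vs].
  exact: le_trans lau (umin _ vs).
exists u => [|v]; first by rewrite /= in_cons; apply/orP; right.
by rewrite /= in_cons => /predU1P[->|/umin//]; exact: ltW.
Qed.

(* What the criterion needs to know about [Linf] and [Lzero], seen as sets of
   functions. In [class_pullback] the values of [f] are controlled by those of
   [g] along a partial section of [phi]. *)
Record weighted_class (R : realType) (T : choiceType) (mu : T -> {posnum R})
    (E : set (T -> R[i])) : Prop := WeightedClass {
  class_bounded : forall f, E f -> f \in wbounded mu ;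
  class_finite : forall f, finite_set [set v | f v <> 0] -> E f ;
  class_uniform : forall f,
    (forall eps, 0 < eps -> exists2 g, E g &
       forall v, (mu v)%:num * normc (f v - g v) <= eps) -> E f ;
  class_pullback : forall (phi : T -> T) (C : R) f g, 0 < C -> E g ->
    (forall u, f u <> 0 -> exists2 v, phi v = u &
       (mu u)%:num * normc (f u) <= C * ((mu v)%:num * normc (g v))) -> E f }.

(** * Unit vectors, ratios and gains *)

Section WcompClass.
Context {R : realType} {T : choiceType} (mu : T -> {posnum R}).
Context (psi : T -> R[i]) (phi : T -> T) (E : set (T -> R[i])).
Hypotheses (EP : weighted_class mu E)
  (Estable : forall f, E f -> E (wcomp psi phi f)).

Definition wunit (u v : T) : R[i] :=
  if v == u then ((mu u)%:num^-1)%:C else 0.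

Definition wratio (v : T) : R :=
  (mu v)%:num / (mu (phi v))%:num * normc (psi v).

Definition wgain (u : T) : R := wsup mu (wcomp psi phi (wunit u)).

Lemma wunit_class u : E (wunit u).
Proof.
apply: (class_finite EP); apply: (sub_finite_set (B := [set u])) => // v /=.
by rewrite /wunit; case: eqP.
Qed.

Lemma wcompM_real f v (a : R) : 0 <= a ->
  f (phi v) = ((mu (phi v))%:num^-1 * a)%:C ->
  (mu v)%:num * normc (wcomp psi phi f v) = wratio v * a.
Proof.
move=> a0 fE; rewrite /wcomp fE normcM normc_real ger0_norm ?mulr_ge0//.
by rewrite /wratio -!mulrA; congr (_ * _); rewrite mulrCA.
Qed.

Lemma wcomp_wunit u v :
  (mu v)%:num * normc (wcomp psi phi (wunit u) v) =
  if phi v == u then wratio v else 0.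
Proof.
case: eqP => [<-|/eqP/negbTE uv].
  by rewrite (@wcompM_real _ _ 1)// ?mulr1// /wunit eqxx.
by rewrite /wcomp /wunit uv mulr0 normc0 mulr0.
Qed.

Lemma wratio_ge0 v : 0 <= wratio v.
Proof. by rewrite !mulr_ge0 ?normc_ge0. Qed.

Lemma wratio_gt0 v : psi v <> 0 -> 0 < wratio v.
Proof.
move=> /eqP v0; rewrite !mulr_gt0 ?invr_gt0 ?gt0// lt_def normc_ge0 andbT.
by apply: contra_neq v0; exact: eq0_normc.
Qed.

Lemma wratio_le v : wratio v <= wgain (phi v).
Proof.
have := wsup_ub v (class_bounded EP (Estable (wunit_class (phi v)))).
by rewrite wcomp_wunit eqxx.
Qed.

Lemma wgain_le u M : 0 <= M -> (forall v, phi v = u -> wratio v <= M) ->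
  wgain u <= M.
Proof.
move=> M0 uM; apply: wsup_le => // v; rewrite wcomp_wunit.
by case: eqP => // /uM.
Qed.

Lemma wgain_gt0 u : 0 < wgain u -> exists2 v, phi v = u & psi v <> 0.
Proof.
move=> u0; apply: contrapT => uN; suff : wgain u <= 0 by rewrite leNgt u0.
apply: wgain_le => // v vu; rewrite /wratio.
have [->|/eqP v0] := eqVneq (psi v) 0; first by rewrite normc0 mulr0.
by case: uN; exists v.
Qed.

(** Closedness of the range, phrased through functions and uniform weighted approximation so that
    both spaces are treated at once. *)
Definition wcomp_closed := forall g, E g ->
  (forall eps, 0 < eps -> exists2 f, E f &
     forall v, (mu v)%:num * normc (g v - wcomp psi phi f v) <= eps) ->
  exists2 f, E f & wcomp psi phi f = g.

(** * Necessity: gains accumulating at 0 contradict closed range *)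

Section Necessity.
Context (l : T -> R) (lfin : forall M, finite_set [set v | l v <= M]).

(* If the gains accumulate at 0 then so do those of the records, yet only
   finitely many records have a gain above any given positive threshold. *)
Definition record (u : T) : Prop :=
  0 < wgain u /\ forall v, l v < l u -> 0 < wgain v -> wgain u < wgain v.

Hypothesis gain0 : forall eps, 0 < eps -> exists u, 0 < wgain u <= eps.

(** A point of least [l] among those with gain in [(0, eps]] is a record: any point of smaller [l]
    and positive gain has gain above [eps]. *)
Lemma record_small eps : 0 < eps -> exists2 u, record u & wgain u <= eps.
Proof.
move=> eps0; have [u0 u0e] := gain0 eps0.
have [||u [uu0 /andP[ug ue]] umin] := @finite_set_argmin _ _ l
    ([set u | l u <= l u0] `&` [set u | 0 < wgain u <= eps]).
- by apply: sub_finite_set (lfin (l u0)) => ? [].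
- by exists u0; split => /=.
exists u => //; split=> // v vu vg; apply: le_lt_trans ue _.
rewrite ltNge; apply/negP => ve; move: (vu); rewrite ltNge umin//.
by split=> /=; [exact: ltW (lt_le_trans vu uu0)|rewrite vg].
Qed.

(** A point [u0] of gain at most [eps / 2] bounds [l]: a record beyond it has gain below that of
    [u0]. *)
Lemma record_finite eps : 0 < eps ->
  finite_set [set u | record u /\ eps <= wgain u].
Proof.
move=> eps0; have [|u0 /andP[u0g u0e]] := gain0 (eps := eps / 2); first lra.
apply: sub_finite_set (lfin (l u0)) => u /= [[ug urec] ue].
rewrite leNgt; apply/negP => /urec /(_ u0g); lra.
Qed.

(** The test function cut off at gain [delta]; [delta = 0] gives the whole unbounded function. *)
Definition blowup (delta : R) (u : T) : R[i] :=
  if `[< record u /\ delta <= wgain u >] then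
    ((mu u)%:num^-1 * (Num.sqrt (wgain u))^-1)%:C else 0.

Lemma blowup_class delta : 0 < delta -> E (blowup delta).
Proof.
move=> d0; apply: (class_finite EP).
apply: sub_finite_set (record_finite d0) => u /=.
by rewrite /blowup; case: asboolP.
Qed.

(** The cut at [eps ^+ 2] drops only records of smaller gain; over these the image has weighted
    modulus at most [gain * gain ^ (-1/2) = gain ^ (1/2) <= eps]. *)
Lemma wcomp_blowup_dist eps v : 0 < eps ->
  (mu v)%:num * normc (wcomp psi phi (blowup 0) v -
                       wcomp psi phi (blowup (eps ^+ 2)) v) <= eps.
Proof.
move=> eps0.
have [[ru small]|nsmall] :=
  pselect (record (phi v) /\ ~ eps ^+ 2 <= wgain (phi v)); last first.
  have -> : wcomp psi phi (blowup (eps ^+ 2)) v = wcomp psi phi (blowup 0) v.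
    rewrite /wcomp /blowup; case: asboolP => [[ru _]|nb]; case: asboolP => //.
      by move=> [] //; split=> //; case: ru => /ltW.
    by move=> [ru _]; case: nb; split=> //; apply: contrapT => ?; exact: nsmall.
  by rewrite subrr normc0 mulr0 ltW.
have -> : wcomp psi phi (blowup (eps ^+ 2)) v = 0.
  by rewrite /wcomp /blowup asboolF ?mulr0// => -[].
rewrite subr0.
have ug : 0 < wgain (phi v) by case: ru.
have sg : 0 < Num.sqrt (wgain (phi v)) by rewrite sqrtr_gt0.
have se : wgain (phi v) <= eps ^+ 2.
  by rewrite leNgt; apply/negP => /ltW ?; exact: small.
rewrite (@wcompM_real (blowup 0) v (Num.sqrt (wgain (phi v)))^-1).
- rewrite ler_pdivrMr//; apply: le_trans (wratio_le v) _.
  rewrite -[leLHS](sqr_sqrtr (ltW ug)) expr2 ler_pM2r//.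
  by rewrite -(ger0_norm (ltW eps0)) -sqrtr_sqr ler_wsqrtr.
- by rewrite invr_ge0 ltW.
- by rewrite /blowup asboolT//; split=> //; exact: ltW.
Qed.

Lemma not_wcomp_closed : ~ wcomp_closed.
Proof.
have near_g eps : 0 < eps -> exists2 f, E f & forall v, (mu v)%:num *
    normc (wcomp psi phi (blowup 0) v - wcomp psi phi f v) <= eps.
  move=> eps0; exists (blowup (eps ^+ 2)); first exact/blowup_class/exprn_gt0.
  by move=> v; exact: wcomp_blowup_dist.
move=> /(_ (wcomp psi phi (blowup 0))) [|//|f Ef fE].
  (* The image lies in [E] as a uniform limit of images of truncations. *)
  apply: (class_uniform EP) => eps /near_g[f Ef fP].
  by exists (wcomp psi phi f) => //; exact: Estable.
have /wboundedP[M fM] := class_bounded EP Ef.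
(* [N] exceeds the bound [M], and a record of gain at most [N ^- 2] carries weighted modulus at
   least [N]. *)
pose N := `|M| + 1.
have N0 : 0 < N by rewrite ltr_wpDl.
have [|u ru ule] := record_small (eps := (N ^- 2)).
  by rewrite invr_gt0 exprn_gt0.
have ug : 0 < wgain u by case: ru.
have [v vu v0] := wgain_gt0 ug.
(* Since [psi v] is nonzero at a point [v] over [u], the preimage is determined at [u]. *)
have fu : f u = blowup 0 u.
  have := congr1 (@^~ v) fE; rewrite /wcomp vu; apply: mulfI; exact/eqP.
have := fM u; rewrite fu /blowup asboolT; last by split=> //; exact: ltW.
rewrite normc_real ger0_norm ?mulr_ge0 ?invr_ge0 ?sqrtr_ge0// mulrA mulfV//.
rewrite mul1r; apply/negP; rewrite -ltNge.
apply: (lt_le_trans (y := N)).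
  by rewrite (le_lt_trans (ler_norm M))// ltrDl.
rewrite -[leLHS]invrK lef_pV2 ?posrE ?sqrtr_gt0 ?invr_gt0//.
have Ni0 : 0 <= N^-1 by rewrite invr_ge0 ltW.
rewrite -[leRHS](ger0_norm Ni0).
by rewrite -sqrtr_sqr ler_wsqrtr// exprVn.
Qed.

End Necessity.

(** If no [eps] works, then for each [eps] some [w] in [Zc] has all ratios over [phi w] below [eps],
    so the gain of [phi w] is positive and at most [eps]. *)
Lemma wcomp_closed_gain (l : T -> R) :
  (forall M, finite_set [set v | l v <= M]) -> wcomp_closed ->
  exists2 eps, 0 < eps &
    forall w, Zc psi w -> Uset mu psi phi eps `&` Sset phi w !=set0.
Proof.
move=> lfin cl; apply: contrapT => noeps.
apply: (not_wcomp_closed lfin) cl => eps eps0.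
apply: contrapT => nogain; apply: noeps; exists eps => // w w0.
apply: contrapT => noU; apply: nogain; exists (phi w).
rewrite (lt_le_trans (wratio_gt0 w0) (wratio_le w))/=.
apply: wgain_le => [|v vw]; first exact: ltW.
by rewrite leNgt; apply/negP => /ltW ev; apply: noU; exists v.
Qed.

(** * Sufficiency: a preimage built from points of large ratio *)

Lemma wcomp_closed_of_gain eps : 0 < eps ->
  (forall w, Zc psi w -> Uset mu psi phi eps `&` Sset phi w !=set0) ->
  wcomp_closed.
Proof.
move=> eps0 epsP g Eg gcl.
(* A single [f] serves both points; the smaller weight turns the weighted bound into a plain one. *)
have approx v w e : 0 < e -> exists f : T -> R[i],
    normc (g v - psi v * f (phi v)) <= e /\
    normc (g w - psi w * f (phi w)) <= e.
  move=> e0; pose m := Num.min (mu v)%:num (mu w)%:num.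
  have m0 : 0 < m by rewrite lt_min !gt0.
  have [f _ fg] := gcl (e * m) (mulr_gt0 e0 m0); exists f.
  have le_e x : m <= (mu x)%:num -> normc (g x - psi x * f (phi x)) <= e.
    move=> mx; rewrite -(ler_pM2l (gt0 (mu x))); apply: le_trans (fg x) _.
    by rewrite mulrC ler_pM2r.
  by split; apply: le_e; rewrite ge_min lexx ?orbT.
have null v : psi v = 0 -> g v = 0.
  move=> v0; apply/eq0_normc/eqP; rewrite eq_le normc_ge0 andbT.
  apply/ler_addgt0Pr => e /(approx v v)[f [+ _]].
  by rewrite v0 mul0r subr0 add0r.
have fibre v w : phi v = phi w -> g v * psi w = g w * psi v.
  move=> vw; apply/eqP; rewrite -subr_eq0; apply/eqP/eq0_normc/eqP.
  rewrite eq_le normc_ge0 andbT; apply/ler_addgt0Pr => e e0; rewrite add0r.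
  pose K := normc (psi w) + normc (psi v) + 1.
  have K0 : 0 < K by rewrite ltr_wpDl// addr_ge0// normc_ge0.
  have [f [fv fw]] := approx v w (e / K) (divr_gt0 e0 K0).
  (* The two products with [f] cancel since [phi v = phi w]. *)
  have -> : g v * psi w - g w * psi v =
      (g v - psi v * f (phi v)) * psi w - (g w - psi w * f (phi w)) * psi v.
    by rewrite vw; ring.
  apply: le_trans (normcD _ _) _; rewrite normcN !normcM.
  apply: (@le_trans _ _ (e / K * (normc (psi w) + normc (psi v)))).
    by rewrite mulrDr lerD// ler_wpM2r ?normc_ge0.
  by rewrite mulrAC ler_pdivrMr// ler_pM2l// lerDl.
(* The implication sits under the existential so that [choice] yields a total [s]. *)
have {}epsP u : exists v, (exists2 w, phi w = u & psi w <> 0) ->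
    [/\ phi v = u, psi v <> 0 & eps <= wratio v].
  have [[w wu /epsP[v [veps vw]]]|no] :=
    pselect (exists2 w, phi w = u & psi w <> 0); last by exists u => /no.
  exists v => _; split=> //; first by rewrite -wu.
  by move=> v0; move: veps; rewrite /Uset/= v0 normc0 mulr0 leNgt eps0.
have [s sP] := choice epsP.
pose f u := if `[< exists2 w, phi w = u & psi w <> 0 >]
            then g (s u) / psi (s u) else 0.
exists f; last first.
  apply/funext => v; rewrite /wcomp /f.
  have [v0|/eqP v0] := eqVneq (psi v) 0.
    by rewrite v0 mul0r null.
  have ex : exists2 w, phi w = phi v & psi w <> 0 by exists v.
  rewrite asboolT//; have [sv s0 _] := sP _ ex.
  by rewrite mulrCA mulrA -fibre // mulfK//; exact/eqP.
(* A ratio at least [eps] at [s u] bounds the weighted modulus of [f] at [u] by [eps^-1] times that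
   of [g] at [s u]. *)
apply: (class_pullback EP (phi := phi) (C := eps^-1) _ Eg).
  by rewrite invr_gt0.
move=> u; rewrite /f; case: asboolP => // ex _.
have [su s0 se] := sP _ ex; exists (s u) => //.
have n0 : 0 < normc (psi (s u)).
  by rewrite lt_def normc_ge0 andbT; apply/eqP => /eq0_normc.
rewrite normcM normcV ler_pdivlMl//.
rewrite /wratio su mulrAC ler_pdivlMr// in se.
rewrite !mulrA ler_pdivrMr//.
rewrite [leRHS]mulrAC.
by rewrite ler_wpM2r ?normc_ge0.
Qed.

End WcompClass.

(** * The two function spaces and topological closedness of the range *)

Section Spaces.
Context {R : realType} {T : choiceType} (mu : T -> {posnum R}).

Lemma wbounded_class : weighted_class mu [set f | f \in wbounded mu].
Proof.
split=> //.
- move=> f fin; apply/wboundedP.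
  have /finite_seqP[s sE] := fin.
  exists (\sum_(v <- s) (mu v)%:num * normc (f v)) => v.
  have [fv|/eqP fv] := eqVneq (f v) 0.
    by rewrite fv normc0 mulr0 sumr_ge0// => w _; rewrite mulr_ge0 ?normc_ge0.
  have vs : v \in s by have : [set` s] v by rewrite -sE.
  rewrite (big_rem v vs)/= lerDl sumr_ge0// => w _.
  by rewrite mulr_ge0 ?normc_ge0.
- move=> f /(_ 1 ltr01)[g /wboundedP[M gM] fg]; apply/wboundedP.
  exists (1 + M) => v; rewrite -[f v](subrK (g v)).
  by apply: le_trans (ler_wpM2l _ (normcD _ _)) _ => //; rewrite mulrDr lerD.
- move=> phi C f g C0 /wboundedP[M gM] fg; apply/wboundedP.
  exists (C * `|M|) => u; have [->|/eqP/fg[v _ /le_trans]] := eqVneq (f u) 0.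
    by rewrite normc0 mulr0 mulr_ge0// ltW.
  by apply; rewrite ler_pM2l// (le_trans (gM v))// ler_norm.
Qed.

(** The [c_0] condition, free of the metric; when bounded sets are finite it agrees with decay as
    the length tends to infinity. *)
Definition vanishing : set (T -> R[i]) :=
  [set f | forall eps, 0 < eps ->
     finite_set [set v | eps <= (mu v)%:num * normc (f v)]].

Lemma vanishing_wbounded f : vanishing f -> f \in wbounded mu.
Proof.
move=> /(_ 1 ltr01)/finite_seqP[s sE]; apply/wboundedP.
exists (1 + \sum_(v <- s) (mu v)%:num * normc (f v)) => v.
have s0 (r : seq T) : 0 <= \sum_(v <- r) (mu v)%:num * normc (f v).
  by rewrite sumr_ge0// => w _; rewrite mulr_ge0 ?normc_ge0.
have [fv|/ltW fv] := leP 1 ((mu v)%:num * normc (f v)); last first.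
  by rewrite (le_trans fv)// lerDl.
have vs : v \in s by have : [set` s] v by rewrite -sE.
by rewrite (big_rem v vs)/= addrCA lerDl addr_ge0.
Qed.

Lemma vanishing_class : weighted_class mu vanishing.
Proof.
split; first exact: vanishing_wbounded.
- move=> f fin eps eps0; apply: sub_finite_set fin => v /= fv f0.
  by move: fv; rewrite f0 normc0 mulr0 leNgt eps0.
- move=> f fu eps eps0; have e2 : 0 < eps / 2 by rewrite divr_gt0.
  have [g g0 fg] := fu _ e2; apply: sub_finite_set (g0 _ e2) => v /= fv.
  have : (mu v)%:num * normc (f v) <=
      (mu v)%:num * normc (f v - g v) + (mu v)%:num * normc (g v).
    by rewrite -mulrDr ler_wpM2l// (le_trans _ (normcD _ _))// subrK.
  by have := fg v; lra.
- move=> phi C f g C0 g0 fg eps eps0.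
  (* Each [u] in the superlevel set of [f] is the image of a point where [g] has weighted modulus at
     least [eps / C]. *)
  apply: sub_finite_set (finite_image phi (g0 (eps / C) (divr_gt0 eps0 C0))).
  move=> u /= fu; have [f0|/eqP/fg[v vu fv]] := eqVneq (f u) 0.
    by move: fu; rewrite f0 normc0 mulr0 leNgt eps0.
  by exists v => //=; rewrite ler_pdivrMr// mulrC (le_trans fu).
Qed.

(** The map [i] identifies [X] isometrically with [E], so balls in [X] are uniform weighted
    bounds. *)
Lemma closed_range_wcomp (E : set (T -> R[i])) (X : normedModType R[i])
    (i : X -> T -> R[i]) (psi : T -> R[i]) (phi : T -> T) (W : X -> X) :
  injective i -> (forall f, E f <-> exists x, i x = f) ->
  (forall f, E f -> f \in wbounded mu) ->
  (forall x y v, i (x - y) v = i x v - i y v) ->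
  (forall x, `|x| = (wsup mu (i x))%:C) ->
  (forall x, i (W x) = wcomp psi phi (i x)) ->
  closed (range W) <-> wcomp_closed mu psi phi E.
Proof.
move=> i_inj iE Eb iB i_norm iW.
have Ei x : E (i x) by apply/iE; exists x.
split=> [Wcl g /iE[y <-] yW|Wcl y yW].
  have /Wcl[x _ xy] : closure (range W) y.
    move=> B /nbhs_ballP[e /= e0 yB].
    (* Radii live in [R[i]], where positivity forces the imaginary part to be 0. *)
    have eE : e = (complex.Re e)%:C.
      by move: e0; rewrite ltcE => /andP[/eqP /= + _]; case: (e) => a b /= ->.
    have re0 : 0 < complex.Re e by rewrite -(ltcR 0) -eE.
    (* Half the radius, because balls are strict while the approximation is not. *)
    have [f /iE[x <-] xy] := yW (complex.Re e / 2) (divr_gt0 re0 (ltr0Sn _ _)).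
    exists (W x); split; [by exists x|apply: yB].
    rewrite -ball_normE/= i_norm eE ltcR.
    apply: (@le_lt_trans _ _ (complex.Re e / 2)); last by lra.
    apply: wsup_le => [|v]; first by rewrite divr_ge0 ?ltW.
    by rewrite iB iW.
  by exists (i x) => //; rewrite -iW xy.
have [|f /iE[x <-] xy] := Wcl (i y) (Ei y).
  move=> eps eps0.
  have [|_ [[x _ <-] +]] := yW (ball y eps%:C).
    by apply: nbhsx_ballx; rewrite (ltcR 0).
  rewrite -ball_normE/= i_norm ltcR => xy; exists (i x) => // v.
  rewrite -iW -iB; apply: le_trans (ltW xy).
  exact/wsup_ub/Eb/Ei.
by exists x => //; apply: i_inj; rewrite iW.
Qed.

End Spaces.


Theorem theorem5p3 (R : realType) (T : metricType R) (o : T)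
    (T_locally_finite : forall M : R, 0 < M -> finite_set [set v | mdist o v < M])
    (T_unbounded : forall M : R, 0 < M -> exists v : T, M <= mdist o v)
    (mu : T -> {posnum R}) (psi : T -> R[i]) (phi : T -> T) :
  (forall W : {linear Linf mu -> Linf mu},
      (forall f : Linf mu, W f = wcomp psi phi f :> (T -> R[i])) ->
      bounded_operator W ->
      (closed (range W) <->
       exists2 eps : R, 0 < eps &
         forall w : T, Zc psi w -> Uset mu psi phi eps `&` Sset phi w !=set0)) /\
  (forall W : {linear Lzero o mu -> Lzero o mu},
      (forall f : Lzero o mu, W f = wcomp psi phi f :> (T -> R[i])) ->
      bounded_operator W ->
      (closed (range W) <->
       exists2 eps : R, 0 < eps &
         forall w : T, Zc psi w -> Uset mu psi phi eps `&` Sset phi w !=set0)).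
Proof.
have lfin M : finite_set [set v | mdist o v <= M].
  apply: sub_finite_set (T_locally_finite (`|M| + 1) _) => [v /= vM|].
    by rewrite (le_lt_trans vM)// (le_lt_trans (ler_norm M))// ltrDl.
  by rewrite ltr_wpDl.
have criterion (E : set (T -> R[i])) : weighted_class mu E ->
    (forall f, E f -> E (wcomp psi phi f)) ->
    wcomp_closed mu psi phi E <-> exists2 eps : R, 0 < eps &
      forall w : T, Zc psi w -> Uset mu psi phi eps `&` Sset phi w !=set0.
  move=> EP Es; split=> [|[eps eps0]]; first exact: wcomp_closed_gain lfin.
  exact: wcomp_closed_of_gain.
have vanishingP (f : Linf mu) : f \in @wvanishing _ _ o mu <-> vanishing mu f.
  split=> [/asboolP/cvgrPdist_le f0 eps eps0|f0].
    have [M _ fM] := f0 _ (divr_gt0 eps0 (ltr0Sn R 1)).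
    apply: sub_finite_set (lfin M) => v /= fv.
    rewrite leNgt; apply/negP => /ltW/fM /=.
    rewrite sub0r normrN ger0_norm ?mulr_ge0 ?normc_ge0//; lra.
  apply/asboolP/cvgrPdist_le => eps eps0.
  have /finite_seqP[s sE] := f0 _ eps0.
  (* This radius exceeds the length of every point of the finite exceptional set [s]. *)
  exists (1 + \sum_(v <- s) mdist o v) => // v /= vM.
  rewrite sub0r normrN ger0_norm ?mulr_ge0 ?normc_ge0// leNgt.
  apply/negP => /ltW fv.
  have vs : v \in s by have : [set` s] v by rewrite -sE.
  move: vM; rewrite (big_rem v vs)/=.
  have : 0 <= \sum_(w <- rem v s) mdist o w.
    by apply: sumr_ge0 => w _; exact: mdist_ge0.
  lra.
split=> W WE _.
- have iE f : f \in wbounded mu <-> exists x : Linf mu, x = f :> (T -> _).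
    by split=> [fb|[x <-]]; [exists (MkLinf fb)|exact: Linf_funP].
  have := @closed_range_wcomp _ _ mu [set f | f \in wbounded mu]
    _ (@Linf_fun _ _ mu) psi phi W val_inj iE.
  move=> -> //; apply: criterion; first exact: wbounded_class.
  by move=> f /iE[x <-]; rewrite -WE; apply/iE; eexists.
- have iE f : vanishing mu f <-> exists x : Lzero o mu, x = f :> (T -> _).
    split=> [f0|[x <-]]; last exact/vanishingP/Lzero_LinfP.
    have xP : MkLinf (vanishing_wbounded f0) \in @wvanishing _ _ o mu.
      exact/vanishingP.
    by exists (MkLzero xP).
  have i_inj : injective (fun x : Lzero o mu => x : T -> R[i]).
    by move=> x y /val_inj/val_inj.
  have := @closed_range_wcomp _ _ mu (vanishing mu)
    _ (fun x : Lzero o mu => x : T -> R[i]) psi phi W i_inj iE.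
  move=> -> //; last exact: vanishing_wbounded.
  apply: criterion; first exact: vanishing_class.
  by move=> f /iE[x <-]; rewrite -WE; apply/iE; eexists.
Qed.
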